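(* The inclusions of classes $$\{\text{Courant algebroids}\}\subseteq\{\text{pre-Courant algebroids}\}\subseteq\{\text{curved Courant algebroids}\}\subseteq\{\text{ante-Courant algebroids}\}$$ are all strict: there exists a pre-Courant algebroid that is not a Courant algebroid, a curved Courant algebroid that is not a pre-Courant algebroid, and an ante-Courant algebroid that is not a curved Courant algebroid.
   Context: Everything is smooth; the base manifold $M$ is arbitrary. A tuple $(\mathbb{E},\langle\,,\rangle,\rho,[\,,])$ over $M$ consists of a vector bundle $\mathbb{E}\to M$, a non-degenerate symmetric pairing $\langle\,,\rangle\in\Gamma(\mathrm{Sym}^2\mathbb{E}^* )$, a vector bundle morphism $\rho:\mathbb{E}\to TM$ over $\mathrm{id}_M$, and an $\mathbb{R}$-bilinear bracket $[\,,]$ on $\Gamma(\mathbb{E})$. Define $\rho^*:T^*M\to\mathbb{E}$ by $\langle\rho^*\alpha,b\rangle=\alpha(\rho(b))$. For $a,b,c\in\Gamma(\mathbb{E})$ consider: (Ca1) $[a,b]+[b,a]=\rho^*d\langle a,b\rangle$; (Ca2) $\rho(a)\langle b,c\rangle=\langle[a,b],c\rangle+\langle b,[a,c]\rangle$; (Ca3) $[a,[b,c]]=[[a,b],c]+[b,[a,c]]$. A metric algebroid is a tuple satisfying (Ca1) and (Ca2). For a metric algebroid let $F(a,b):=\rho([a,b])-[\rho(a),\rho(b)]_{\mathrm{Lie}}$. A metric algebroid is - a Courant algebroid if (Ca3) holds; - a pre-Courant algebroid if $F=0$; - a curved Courant algebroid if $F$ is $C^\infty(M)$-bilinear and skew-symmetric,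 i.e. $F\in\Gamma(\wedge^2\mathbb{E}^*\otimes TM)$, and $F(a,b)=0$ whenever $a\in\ker\rho$ (pointwise); - an ante-Courant algebroid if $F$ is $C^\infty(M)$-bilinear and skew-symmetric, i.e. $F\in\Gamma(\wedge^2\mathbb{E}^*\otimes TM)$. *)

(* Defs.v *)
From HB Require Import structures.
From mathcomp Require Import all_boot all_order all_algebra.
From mathcomp Require Import sesquilinear ring.
From mathcomp Require Import all_classical all_reals topology normedtype derive.

Set Implicit Arguments.
Unset Strict Implicit.
Unset Printing Implicit Defensive.

Import Order.TTheory GRing.Theory Num.Theory.
Import numFieldNormedType.Exports.

Local Open Scope classical_set_scope.
Local Open Scope ring_scope.

Section SmoothEuclidean.
Variables (R : realType) (n : nat).
Implicit Types (U V : set 'rV[R]_n) (f g : 'rV[R]_n -> R).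

(* All partial derivatives of order at most [k] exist and are continuous at
   every point of [U]; only meaningful when [U] is open. *)
Fixpoint Ck_on (k : nat) U f : Prop :=
  (forall x, U x -> {for x, continuous f}) /\
  if k is k'.+1 then
    forall i : 'I_n, (forall x, U x -> derivable f x (delta_mx 0 i)) /\
                     Ck_on k' U ('D_(delta_mx 0 i) f)
  else True.

Definition Cinf_on U f : Prop := forall k, Ck_on k U f.

Lemma Ck_cont k U f x : Ck_on k U f -> U x -> {for x, continuous f}.
Proof. by case: k => [|k] [cf _]; exact: cf. Qed.

Lemma CkS k U f : Ck_on k.+1 U f -> Ck_on k U f.
Proof.
elim: k f => [|k IH] f [cf df]; split=> // i.
by have [d1 d2] := df i; split=> //; apply: IH.
Qed.

Lemma Ck_sub k U V f : U `<=` V -> Ck_on k V f -> Ck_on k U f.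
Proof.
move=> UV; elim: k f => [|k IH] f [cf df]; split=> //.
- by move=> x /UV; exact: cf.
- by move=> x /UV; exact: cf.
- move=> i; have [d1 d2] := df i; split; last exact: IH.
  by move=> x /UV; exact: d1.
Qed.

Lemma Ck_eq k U f g : open U -> (forall x, U x -> f x = g x) ->
  Ck_on k U f -> Ck_on k U g.
Proof.
move=> oU.
have nfg (f' g' : 'rV[R]_n -> R) x : (forall y, U y -> f' y = g' y) -> U x ->
    \forall y \near x, f' y = g' y.
  by move=> fg Ux; apply: filterS fg _; apply: open_nbhs_nbhs; split.
have cfg (f' g' : 'rV[R]_n -> R) x : (forall y, U y -> f' y = g' y) -> U x ->
    {for x, continuous f'} -> {for x, continuous g'}.
  move=> fg Ux cf; rewrite /prop_for /continuous_at -fg//.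
  apply: cvg_trans cf; apply: (@near_eq_cvg _ _ (nbhs x)); exact: nfg.
elim: k f g => [|k IH] f g fg [cf df].
  by split=> // x Ux; exact: cfg (cf x Ux).
split=> [x Ux|i]; first exact: cfg (cf x Ux).
have [d1 d2] := df i; split=> [x Ux|].
  by apply: near_eq_derivable (d1 x Ux); exact: nfg.
by apply: IH d2 => x Ux; apply: near_eq_derive; exact: nfg.
Qed.

Lemma Ck_cst k U (c : R) : Ck_on k U (cst c).
Proof.
elim: k c => [|k IH] c; first by split=> // x _; exact: cst_continuous.
split=> [x _|i]; first exact: cst_continuous.
split=> [x _|]; first exact: derivable_cst.
rewrite (_ : 'D__ _ = cst 0); first exact: IH.
by apply/funext => x; exact: derive_cst.
Qed.

Lemma Ck_add k U f g : open U -> Ck_on k U f -> Ck_on k U g ->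
  Ck_on k U (f \+ g).
Proof.
move=> oU; elim: k f g => [|k IH] f g [cf df] [cg dg].
  by split=> // x Ux; exact: cvgD (cf x Ux) (cg x Ux).
split=> [x Ux|i]; first exact: cvgD (cf x Ux) (cg x Ux).
have [df1 df2] := df i; have [dg1 dg2] := dg i.
split=> [x Ux|]; first exact: derivableD (df1 x Ux) (dg1 x Ux).
apply: Ck_eq (IH _ _ df2 dg2) => // x Ux /=.
by rewrite [RHS]deriveD; [|exact: df1|exact: dg1].
Qed.

Lemma Ck_mul k U f g : open U -> Ck_on k U f -> Ck_on k U g ->
  Ck_on k U (f \* g).
Proof.
move=> oU; elim: k f g => [|k IH] f g.
  by move=> [cf _] [cg _]; split=> // x Ux; exact: cvgM (cf x Ux) (cg x Ux).
move=> kf kg; have [cf df] := kf; have [cg dg] := kg.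
split=> [x Ux|i]; first exact: cvgM (cf x Ux) (cg x Ux).
have [df1 df2] := df i; have [dg1 dg2] := dg i.
split=> [x Ux|]; first exact: derivableM (df1 x Ux) (dg1 x Ux).
apply: (@Ck_eq _ _ ((f \* 'D_(delta_mx 0 i) g) \+ (g \* 'D_(delta_mx 0 i) f)))
  => // [x Ux /=|].
  by rewrite [RHS]deriveM; [|exact: df1|exact: dg1].
by apply: Ck_add => //; apply: IH => //; exact: CkS.
Qed.

End SmoothEuclidean.

Record chart (R : realType) (n : nat) (M : topologicalType) := Chart {
  chart_dom : set M;
  chart_map : M -> 'rV[R]_n;
  chart_inv : 'rV[R]_n -> M;
  chart_dom_open : open chart_dom;
  chart_img_open : open (chart_map @` chart_dom);
  chart_mapK : forall x, chart_dom x -> chart_inv (chart_map x) = x;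
  chart_map_cont : forall x, chart_dom x -> {for x, continuous chart_map};
  chart_inv_cont :
    forall y, (chart_map @` chart_dom) y -> {for y, continuous chart_inv} }.

Record manifold (R : realType) := Manifold {
  mcarrier :> topologicalType;
  mdim : nat;
  manifold_hausdorff : hausdorff_space mcarrier;
  manifold_second_countable : @second_countable mcarrier;
  atlas : set (chart R mdim mcarrier);
  atlas_cover : forall x, exists2 c, atlas c & chart_dom c x;
  atlas_compat : forall c d, atlas c -> atlas d -> forall i : 'I_mdim,
    Cinf_on (chart_map c @` (chart_dom c `&` chart_dom d))
            (fun y => chart_map d (chart_inv c y) 0 i) }.

Section SmoothFunctions.
Variables (R : realType) (M : manifold R).
Implicit Types (U V : set M) (f g : M -> R).

Definition smooth_on U f : Prop := forall c, @atlas R M c ->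
  Cinf_on (chart_map c @` (chart_dom c `&` U)) (f \o chart_inv c).

Lemma chart_img_openI (c : chart R (mdim M) M) U : open U ->
  open (chart_map c @` (chart_dom c `&` U)).
Proof.
move=> oU; rewrite openE => _ [x [cx Ux] <-].
have inv_x : nbhs (chart_map c x) (chart_inv c @^-1` U).
  apply: chart_inv_cont; first by exists x.
  by rewrite chart_mapK//; apply: open_nbhs_nbhs.
have img_x : nbhs (chart_map c x) (chart_map c @` chart_dom c).
  by apply: open_nbhs_nbhs; split; [exact: chart_img_open|exists x].
apply: filterS (filterI inv_x img_x) => y [/= Uy [z cz zy]].
by exists z => //; split=> //; rewrite -zy chart_mapK// in Uy.
Qed.

Lemma smooth_on_sub U V f : U `<=` V -> smooth_on V f -> smooth_on U f.
Proof.
move=> UV sf c ac k; apply: Ck_sub (sf c ac k).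
by apply: image_subset => x [cx /UV Vx].
Qed.

Lemma smooth_on_eq U f g : open U -> (forall x, U x -> f x = g x) ->
  smooth_on U f -> smooth_on U g.
Proof.
move=> oU fg sf c ac k; apply: Ck_eq (sf c ac k); first exact: chart_img_openI.
by move=> _ [x [cx Ux] <-] /=; rewrite chart_mapK// fg.
Qed.

Lemma smooth_on_cst U (c : R) : smooth_on U (cst c).
Proof. by move=> d ad k; exact: Ck_cst. Qed.

Lemma smooth_on_add U f g : open U -> smooth_on U f -> smooth_on U g ->
  smooth_on U (f \+ g).
Proof.
by move=> oU sf sg c ac k; apply: Ck_add; [exact: chart_img_openI|exact: sf..|exact: sg].
Qed.

Lemma smooth_on_mul U f g : open U -> smooth_on U f -> smooth_on U g ->
  smooth_on U (f \* g).
Proof.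
by move=> oU sf sg c ac k; apply: Ck_mul; [exact: chart_img_openI|exact: sf..|exact: sg].
Qed.

Definition smooth : {pred M -> R} := mem [set f | smooth_on setT f].

Record smoothFun := SmoothFun {
  smoothFun_fun :> M -> R;
  smoothFun_smooth : smoothFun_fun \in smooth }.

HB.instance Definition _ := [isSub for smoothFun_fun].
HB.instance Definition _ := [Choice of smoothFun by <:].

Lemma smooth_subring_closed : subring_closed smooth.
Proof.
split=> [|f g|f g]; rewrite !inE /=.
- exact: smooth_on_cst.
- move=> sf sg; rewrite (_ : f - g = f \+ (cst (-1) \* g)); last first.
    by apply/funext => x /=; rewrite mulN1r.
  apply: smooth_on_add => //; first exact: openT.
  by apply: smooth_on_mul => //; [exact: openT|exact: smooth_on_cst].
- by move=> sf sg; apply: smooth_on_mul => //; exact: openT.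
Qed.
HB.instance Definition _ :=
  GRing.isSubringClosed.Build _ smooth smooth_subring_closed.
HB.instance Definition _ := GRing.SubChoice_isSubComPzRing.Build _ _ smoothFun
  smooth_subring_closed.

Lemma smooth_scaler_closed : GRing.scaler_closed smooth.
Proof.
move=> c f; rewrite !inE => sf.
by apply: (@smooth_on_mul _ (cst c)) => //; [exact: openT|exact: smooth_on_cst].
Qed.
HB.instance Definition _ :=
  GRing.isScaleClosed.Build R (M -> R) smooth smooth_scaler_closed.
HB.instance Definition _ := [SubZmodule_isSubLmodule of smoothFun by <:].

Lemma smoothFunP (f : smoothFun) : smooth_on setT f.
Proof. by have := smoothFun_smooth f; rewrite inE. Qed.

Definition mk_smooth f (sf : smooth_on setT f) : smoothFun :=
  SmoothFun (mem_set sf).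

Lemma smoothFun_eq (f g : smoothFun) : (forall x, f x = g x) -> f = g.
Proof. by move=> fg; apply/val_inj/funext. Qed.

End SmoothFunctions.

Section Tangent.
Variables (R : realType) (M : manifold R).
Local Notation C := (smoothFun M).

(* The tangent space at [x] is the space of derivations at [x] of the algebra of
   globally defined smooth functions. *)
Definition derivation_at (x : M) : {pred C -> R} := mem [set D |
  (forall (c : R) (f g : C), D (c *: f + g) = c * D f + D g) /\
  (forall f g : C, D (f * g) = f x * D g + D f * g x)].

Record tangent (x : M) := Tangent {
  tangent_fun :> C -> R;
  tangent_der : tangent_fun \in derivation_at x }.

HB.instance Definition _ x := [isSub for @tangent_fun x].
HB.instance Definition _ x := [Choice of tangent x by <:].

Lemma derivation_submod_closed x : submod_closed (derivation_at x).
Proof.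
split=> [|c D D']; rewrite !inE /=.
  by split=> [c f g|f g]; rewrite ?mulr0 ?mul0r addr0.
have E h : (c *: D + D') h = c * D h + D' h by [].
by move=> [DZ DM] [D'Z D'M]; split=> [d f g|f g]; rewrite !E ?DZ ?D'Z ?DM ?D'M; ring.
Qed.
HB.instance Definition _ x := GRing.isSubmodClosed.Build R (C -> R)
  (derivation_at x) (derivation_submod_closed x).
HB.instance Definition _ x := [SubChoice_isSubLmodule of tangent x by <:].

Lemma tangentZ x (v : tangent x) (c : R) (f g : C) :
  v (c *: f + g) = c * v f + v g.
Proof. by have := tangent_der v; rewrite inE => -[-> _]. Qed.

Lemma tangentM x (v : tangent x) (f g : C) :
  v (f * g) = f x * v g + v f * g x.
Proof. by have := tangent_der v; rewrite inE => -[_ ->]. Qed.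

Definition differential (f : C) (x : M) (v : tangent x) : R := v f.
Arguments differential f x v : clear implicits.

Lemma differential_is_scalar f x : scalar (differential f x).
Proof. by []. Qed.
HB.instance Definition _ f x :=
  GRing.isLinear.Build R (tangent x) R *%R (differential f x)
    (@differential_is_scalar f x).

(* A field of derivations is smooth iff it maps smooth functions to smooth
   functions, i.e. iff its components in every chart are smooth. *)
Record vectorField := VectorField {
  vectorField_fun :> forall x, tangent x;
  vectorField_smooth :
    forall f : C, smooth_on setT (fun x => vectorField_fun x f) }.

Definition lie_derivative (X : vectorField) (f : C) : C :=
  mk_smooth (vectorField_smooth X f).

Lemma lie_derivativeZ X (c : R) f g : lie_derivative X (c *: f + g) =
  c *: lie_derivative X f + lie_derivative X g.
Proof. by apply: smoothFun_eq => x; exact: tangentZ. Qed.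

Lemma lie_derivativeM X f g : lie_derivative X (f * g) =
  f * lie_derivative X g + lie_derivative X f * g.
Proof. by apply: smoothFun_eq => x; exact: tangentM. Qed.

Definition lie_bracket_fun (X Y : vectorField) (x : M) (f : C) : R :=
  X x (lie_derivative Y f) - Y x (lie_derivative X f).

Lemma lie_bracket_der X Y x : lie_bracket_fun X Y x \in derivation_at x.
Proof.
have tD (v : tangent x) (f g : C) : v (f + g) = v f + v g.
  by have := tangentZ v 1 f g; rewrite scale1r mul1r.
rewrite inE; split=> [c f g|f g]; rewrite /lie_bracket_fun.
  by rewrite !lie_derivativeZ !tangentZ; ring.
by rewrite !lie_derivativeM !tD !tangentM /=; ring.
Qed.

Lemma lie_bracket_smooth X Y f :
  smooth_on setT (fun x => Tangent (lie_bracket_der X Y x) f).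
Proof.
exact: smoothFunP (lie_derivative X (lie_derivative Y f)
                   - lie_derivative Y (lie_derivative X f)).
Qed.

Definition lie_bracket (X Y : vectorField) : vectorField :=
  VectorField (lie_bracket_smooth X Y).

End Tangent.
Arguments differential {R M} f x v.

Record trivialization (R : realType) (M : manifold R) (E : M -> lmodType R)
    (r : nat) := Trivialization {
  triv_dom : set M;
  triv_map : forall x, {linear E x -> 'rV[R]_r};
  triv_dom_open : open triv_dom;
  triv_bij : forall x, triv_dom x -> bijective (triv_map x) }.

(* The bundle structure on the family of fibres is given by a family of
   fibrewise linear local trivializations with smooth transition matrices. *)
Record vectorBundle (R : realType) (M : manifold R) := VectorBundle {
  fiber :> M -> lmodType R;
  bundle_rank : nat;
  trivs : set (trivialization fiber bundle_rank);
  triv_cover : forall x, exists2 t, trivs t & triv_dom t x;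
  triv_compat : forall s t, trivs s -> trivs t ->
    exists g : M -> 'M[R]_bundle_rank,
      (forall i j, smooth_on (triv_dom s `&` triv_dom t) (fun x => g x i j)) /\
      (forall x, (triv_dom s `&` triv_dom t) x ->
        forall v, triv_map t x v = triv_map s x v *m g x) }.

Section Sections.
Variables (R : realType) (M : manifold R) (E : vectorBundle M).

(* A section over [U] is represented by a section of all of [E] whose values
   outside [U] are irrelevant. *)
Definition smooth_section_on (U : set M) (s : forall x, E x) : Prop :=
  forall t, @trivs R M E t -> forall j,
    smooth_on (triv_dom t `&` U) (fun x => triv_map t x (s x) 0 j).

Record bundleSection := BundleSection {
  section_fun :> forall x, E x;
  section_smooth : smooth_section_on setT section_fun }.

HB.instance Definition _ := gen_eqMixin bundleSection.
HB.instance Definition _ := gen_choiceMixin bundleSection.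

Implicit Types (a b : bundleSection) (f : smoothFun M).

Lemma section_eq a b : (forall x, a x = b x) -> a = b.
Proof.
case: a b => [a sa] [b sb] /= ab.
have eab : a = b by exact: functional_extensionality_dep.
by subst b; congr BundleSection; exact: Prop_irrelevance.
Qed.

Let oTI (t : trivialization E (bundle_rank E)) : open (triv_dom t `&` setT).
Proof. by rewrite setIT; exact: triv_dom_open. Qed.

Lemma section0_smooth : smooth_section_on setT (fun x => 0 : E x).
Proof.
move=> t tt j; apply: smooth_on_eq (@smooth_on_cst _ _ _ 0) => //.
by move=> x _; rewrite linear0 mxE.
Qed.

Lemma section_add_smooth a b : smooth_section_on setT (fun x => a x + b x).
Proof.
move=> t tt j.
apply: smooth_on_eq (smooth_on_add _ (section_smooth a tt j)
  (section_smooth b tt j)) => // x _ /=.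
by rewrite linearD mxE.
Qed.

Lemma section_scale_smooth f a : smooth_section_on setT (fun x => f x *: a x).
Proof.
move=> t tt j.
have sf : smooth_on (triv_dom t `&` setT) f.
  by apply: smooth_on_sub (smoothFunP f).
apply: smooth_on_eq (smooth_on_mul _ sf (section_smooth a tt j)) => // x _ /=.
by rewrite linearZ mxE.
Qed.

Definition section0 := BundleSection section0_smooth.
Definition section_add a b := BundleSection (section_add_smooth a b).
Definition section_fscale f a := BundleSection (section_scale_smooth f a).
Definition section_opp a := section_fscale (-1) a.
Definition section_scale (c : R) a :=
  section_fscale (mk_smooth (@smooth_on_cst _ M _ c)) a.

Lemma section_addA : associative section_add.
Proof. by move=> a b c; apply: section_eq => x; exact: addrA. Qed.
Lemma section_addC : commutative section_add.
Proof. by move=> a b; apply: section_eq => x; exact: addrC. Qed.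
Lemma section_add0 : left_id section0 section_add.
Proof. by move=> a; apply: section_eq => x; exact: add0r. Qed.
Lemma section_addN : left_inverse section0 section_opp section_add.
Proof. by move=> a; apply: section_eq => x /=; rewrite scaleN1r addNr. Qed.
HB.instance Definition _ := GRing.isZmodule.Build bundleSection
  section_addA section_addC section_add0 section_addN.

Lemma section_scaleA c d a :
  section_scale c (section_scale d a) = section_scale (c * d) a.
Proof. by apply: section_eq => x; exact: scalerA. Qed.
Lemma section_scale1 : left_id 1 section_scale.
Proof. by move=> a; apply: section_eq => x; exact: scale1r. Qed.
Lemma section_scaleDr : right_distributive section_scale +%R.
Proof. by move=> c a b; apply: section_eq => x; exact: scalerDr. Qed.
Lemma section_scaleDl a : {morph section_scale^~ a : c d / c + d}.
Proof. by move=> c d; apply: section_eq => x; exact: scalerDl. Qed.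
HB.instance Definition _ := GRing.Zmodule_isLmodule.Build R bundleSection
  section_scaleA section_scale1 section_scaleDr section_scaleDl.

End Sections.

Notation "f '*s' a" := (section_fscale f a)
  (at level 40, left associativity) : ring_scope.

Record pseudoMetric (R : realType) (M : manifold R) (E : vectorBundle M) :=
  PseudoMetric {
  pairing_fun :> forall x, {biscalar E x};
  pairing_sym : forall x (u v : E x), pairing_fun x u v = pairing_fun x v u;
  pairing_nondegenerate :
    forall x (u : E x), (forall v, pairing_fun x u v = 0) -> u = 0;
  pairing_smooth : forall (U : set M) (a b : forall x, E x), open U ->
    smooth_section_on U a -> smooth_section_on U b ->
    smooth_on U (fun x => pairing_fun x (a x) (b x)) }.

(* Vector bundle morphisms to the tangent bundle over the identity; smoothness
   means that smooth local sections are sent to smooth local vector fields. *)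
Record anchorMap (R : realType) (M : manifold R) (E : vectorBundle M) :=
  AnchorMap {
  anchor_fun :> forall x, {linear E x -> tangent x};
  anchor_smooth : forall (U : set M) (a : forall x, E x), open U ->
    smooth_section_on U a ->
    forall f : smoothFun M, smooth_on U (fun x => anchor_fun x (a x) f) }.

(* The bracket is only assumed to be bilinear over the field of constants. *)
Record algebroid (R : realType) (M : manifold R) := Algebroid {
  bundle : vectorBundle M;
  pairing : pseudoMetric bundle;
  anchor : anchorMap bundle;
  bracket : bundleSection bundle -> bundleSection bundle ->
            bundleSection bundle;
  bracket_linear_r : forall a, linear (bracket a);
  bracket_linear_l : forall b, linear (bracket^~ b) }.

Section Algebroids.
Variables (R : realType) (M : manifold R) (A : algebroid M).
Local Notation E := (bundle A).
Implicit Types (a b c : bundleSection E) (f : smoothFun M).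

Lemma sec_pairing_smooth a b : smooth_on setT (fun x => pairing A x (a x) (b x)).
Proof. exact: pairing_smooth openT (section_smooth a) (section_smooth b). Qed.

Definition sec_pairing a b : smoothFun M := mk_smooth (sec_pairing_smooth a b).

Definition sec_anchor a : vectorField M :=
  VectorField (anchor_smooth (anchor A) openT (section_smooth a)).

Lemma rho_star_ex (x : M) (alpha : {scalar tangent x}) :
  exists e : E x, forall b : E x, pairing A x e b = alpha (anchor A x b).
Proof.
have [t _ tx] := triv_cover E x.
have [psi phiK psiK] := triv_bij tx.
set phi := triv_map t x in phiK psiK.
have psiZ (k : R) u v : psi (k *: u + v) = k *: psi u + psi v.
  by apply: (can_inj phiK); rewrite psiK linearP !psiK.
have psiP : linear psi by [].
pose psiL : {linear _ -> _} :=
  HB.pack psi (GRing.isLinear.Build R 'rV[R]_(bundle_rank E) (E x) *:%R psi psiP).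
pose e_ i : E x := psiL (delta_mx 0 i).
have psi_sum v : psi v = \sum_i v 0 i *: e_ i.
  rewrite -[psi]/(psiL : _ -> _) [in LHS](row_sum_delta v) linear_sum.
  by apply: eq_bigr => i _; rewrite linearZ.
pose G := \matrix_(i, j) pairing A x (e_ i) (e_ j).
have pairl u w : pairing A x (psi u) w = \sum_i u 0 i * pairing A x (e_ i) w.
  by rewrite psi_sum linear_sumlz; apply: eq_bigr => i _; rewrite linearZl_LR.
have pairE u j : pairing A x (psi u) (e_ j) = (u *m G) 0 j.
  by rewrite pairl mxE; apply: eq_bigr => i _; rewrite mxE.
have bE (b : E x) : b = \sum_i phi b 0 i *: e_ i by rewrite -psi_sum phiK.
have Gunit : G \in unitmx.
  rewrite -row_free_unit -kermx_eq0; apply/eqP/row_matrixP => i.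
  rewrite row0; apply: (can_inj psiK); rewrite (_ : psi 0 = 0); last exact: (linear0 psiL).
  apply: (pairing_nondegenerate (p := pairing A)) => v.
  rewrite (bE v) linear_sumr big1// => j _; rewrite linearZr_LR.
  have /row_matrixP/(_ i) := mulmx_ker G; rewrite row_mul row0 => kG.
  by rewrite /= pairE kG mxE mulr0.
pose w : 'rV[R]_(bundle_rank E) := \row_j alpha (anchor A x (e_ j)).
exists (psi (w *m invmx G)) => b.
rewrite (bE b) linear_sumr !linear_sum; apply: eq_bigr => j _.
by rewrite linearZr_LR /= pairE mulmxKV// mxE !linearZ.
Qed.

(* [rho_starP] and [rho_star_unique] show that the default value is never
   reached and that the choice is unique. *)
Definition rho_star (x : M) (alpha : {scalar tangent x}) : E x :=
  xget 0 [set e | forall b : E x, pairing A x e b = alpha (anchor A x b)].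

Lemma rho_starP (x : M) (alpha : {scalar tangent x}) (b : E x) :
  pairing A x (rho_star alpha) b = alpha (anchor A x b).
Proof. exact: (xgetPex 0 (rho_star_ex alpha)) b. Qed.

Lemma rho_star_unique (x : M) (alpha : {scalar tangent x}) e :
  (forall b : E x, pairing A x e b = alpha (anchor A x b)) -> e = rho_star alpha.
Proof.
move=> eP; apply/eqP; rewrite -subr_eq0; apply/eqP.
apply: (pairing_nondegenerate (p := pairing A)) => b.
by rewrite linearBl eP rho_starP subrr.
Qed.

Definition Ca1 : Prop := forall a b x,
  (bracket a b + bracket b a) x = rho_star (differential (sec_pairing a b) x).

Definition Ca2 : Prop := forall a b c,
  lie_derivative (sec_anchor a) (sec_pairing b c) =
  sec_pairing (bracket a b) c + sec_pairing b (bracket a c).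

Definition Ca3 : Prop := forall a b c,
  bracket a (bracket b c) = bracket (bracket a b) c + bracket b (bracket a c).

(* The map F of the definitions of pre-, curved and ante-Courant algebroids. *)
Definition curvature a b x : tangent x :=
  sec_anchor (bracket a b) x - lie_bracket (sec_anchor a) (sec_anchor b) x.

Definition curvature_bilinear : Prop :=
  (forall f a a' b x, curvature (f *s a + a') b x =
     f x *: curvature a b x + curvature a' b x) /\
  (forall f a b b' x, curvature a (f *s b + b') x =
     f x *: curvature a b x + curvature a b' x).

Definition curvature_skew : Prop :=
  forall a b x, curvature a b x = - curvature b a x.

Definition metric_algebroid : Prop := Ca1 /\ Ca2.

Definition courant_algebroid : Prop := metric_algebroid /\ Ca3.

Definition pre_courant_algebroid : Prop :=
  metric_algebroid /\ forall a b x, curvature a b x = 0.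

Definition curved_courant_algebroid : Prop :=
  [/\ metric_algebroid, curvature_bilinear, curvature_skew &
    forall a b x, anchor A x (a x) = 0 -> curvature a b x = 0].

Definition ante_courant_algebroid : Prop :=
  [/\ metric_algebroid, curvature_bilinear & curvature_skew].

End Algebroids.

(* Main.v *)
Require Import Defs.
From HB Require Import structures.
From mathcomp Require Import all_boot all_order all_algebra.
From mathcomp Require Import sesquilinear ring.
From mathcomp Require Import all_classical all_reals topology normedtype derive.

Set Implicit Arguments.
Unset Strict Implicit.
Unset Printing Implicit Defensive.

Import Order.TTheory GRing.Theory Num.Theory.
Import numFieldNormedType.Exports.

Local Open Scope classical_set_scope.
Local Open Scope ring_scope.

(** Write F for the curvature and rho for the anchor.

    Inclusions. Only the first one needs an argument. Fix sections a and b. By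
    (Ca2) and (Ca3) the derivation F(a,b) kills every function <c,d>
    ([curvature_pairing]). Replacing c by f c and using the Leibniz rule of the
    derivation gives F(a,b)(f) <c,d> = 0 for all functions f and all sections
    c, d. Now take for c the section rho^* dg, which is smooth because in a
    local frame its coordinates come from the inverse of the Gram matrix
    ([rho_star_smooth]): as <rho^* dg, d> = rho(d)(g), the function F(a,b)(f) is
    annihilated by every rho(d)(g). But up to signs it is itself a sum of three
    functions of this form, so its square vanishes ([courant_curvature0]).

    Strictness. On a trivial bundle over R^n with constant metric < , > and
    constant anchor rho, the formula
      bracket a b = D_(rho a) b - D_(rho b) a + rho^* <D a, b> + T(a,b)
    defines a metric algebroid for every constant 3-form T on the fibre, where
    T(a,b) is the vector dual to T(a,b,-) ([constant_Ca1], [constant_Ca2]). If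
    the image of rho^* is isotropic, its curvature is F(a,b) = rho(T(a,b))
    ([constant_curvature], which rests on the symmetry of second derivatives,
    [derive_comm]). This is tensorial and skew, so all these algebroids are
    ante-Courant. The three examples differ in the choice of the data:
    - pre-Courant, not Courant: over a point, the Euclidean space R^5 and the
      3-form e0 e1 e2 + e0 e3 e4, whose bracket violates the Jacobi identity;
    - curved Courant, not pre-Courant: on TM + T^*M over R^2, the trivector
      dx0 dx1 del0. In rho(T(a,b)) only the components of a and b along TM
      occur, so that it vanishes if rho(a) = 0, but rho(T(del0,del1)) = del0;
    - ante-Courant, not curved Courant: on the same bundle, the trivector
      del0 del1 dx0. Here rho(dx0) = 0 but rho(T(dx0,del0)) = - del1. *)

(** * Calculus of smooth functions *)

Section SmoothCalculus.
Variables (R : realType) (M : manifold R).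

Lemma Ck_inv n k (U : set 'rV[R]_n) (f : 'rV[R]_n -> R) : open U ->
  (forall x, U x -> f x != 0) -> Ck_on k U f -> Ck_on k U (fun x => (f x)^-1).
Proof.
move=> oU f0; elim: k => [|k IH] kf.
  by split=> // x Ux; apply: cvgV (Ck_cont kf Ux); exact: f0.
have [cf df] := kf; split=> [x Ux|i]; first by apply: cvgV (cf x Ux); exact: f0.
have [df1 df2] := df i; have kV := IH (CkS kf).
split=> [x Ux|]; first by apply: derivableV (df1 x Ux); exact: f0.
apply: (@Ck_eq _ _ _ _ (cst (-1) \* ((fun x => (f x)^-1) \* (fun x => (f x)^-1))
  \* 'D_(delta_mx 0 i) f)) => // [x Ux /=|].
  rewrite deriveV; [|exact: f0|exact: df1].
  by rewrite /GRing.scale /= mulN1r -exprVn expr2.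
apply: Ck_mul => //; apply: Ck_mul => //; [exact: Ck_cst|exact: Ck_mul].
Qed.

Implicit Types (U : set M) (f g : M -> R).

Lemma smooth_on_inv U f : open U -> (forall x, U x -> f x != 0) ->
  smooth_on U f -> smooth_on U (fun x => (f x)^-1).
Proof.
move=> oU f0 sf c ac k; apply: Ck_inv (sf c ac k); first exact: chart_img_openI.
by move=> _ [x [cx Ux] <-] /=; rewrite chart_mapK// f0.
Qed.

Lemma smooth_on_sum (I : Type) (r : seq I) (P : pred I) U (F : I -> M -> R) :
  open U -> (forall i, P i -> smooth_on U (F i)) ->
  smooth_on U (fun x => \sum_(i <- r | P i) F i x).
Proof.
move=> oU sF; rewrite -fct_sumE.
apply: (big_ind (smooth_on U)) => //; first exact: smooth_on_cst.
by move=> f g sf sg; exact: smooth_on_add.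
Qed.

Lemma smooth_on_prod (I : Type) (r : seq I) (P : pred I) U (F : I -> M -> R) :
  open U -> (forall i, P i -> smooth_on U (F i)) ->
  smooth_on U (fun x => \prod_(i <- r | P i) F i x).
Proof.
move=> oU sF; rewrite -fct_prodE.
apply: (big_ind (smooth_on U)) => //; first exact: smooth_on_cst.
by move=> f g sf sg; exact: smooth_on_mul.
Qed.

Lemma smooth_on_det n U (G : M -> 'M[R]_n) : open U ->
  (forall i j, smooth_on U (fun x => G x i j)) ->
  smooth_on U (fun x => \det (G x)).
Proof.
move=> oU sG; apply: smooth_on_sum => // s _.
apply: (@smooth_on_mul _ _ _ (cst _)) => //; first exact: smooth_on_cst.
exact: smooth_on_prod.
Qed.

(** Cramer's rule: the entries are cofactors divided by the determinant. *)
Lemma smooth_on_invmx n U (G : M -> 'M[R]_n) : open U ->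
  (forall x, U x -> G x \in unitmx) ->
  (forall i j, smooth_on U (fun x => G x i j)) ->
  forall i j, smooth_on U (fun x => invmx (G x) i j).
Proof.
move=> oU uG sG i j.
apply: (@smooth_on_eq _ _ _
  (fun x => (\det (G x))^-1 * cofactor (G x) j i)) => //.
  by move=> x Ux; rewrite /invmx uG// !mxE.
apply: smooth_on_mul => //.
  apply: smooth_on_inv => //; last exact: smooth_on_det.
  by move=> x Ux; rewrite -unitfE -unitmxE uG.
apply: (@smooth_on_mul _ _ _ (cst _)) => //; first exact: smooth_on_cst.
apply: smooth_on_det => // k l.
by apply: smooth_on_eq (sG (lift j k) (lift i l)) => // x Ux; rewrite !mxE.
Qed.

End SmoothCalculus.

(** * The section dual to a differential through the anchor *)

Section AnchorDual.
Variables (R : realType) (M : manifold R) (A : algebroid M).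
Local Notation E := (bundle A).
Local Notation r := (bundle_rank E).

(** The frame of a trivialization, extended by an arbitrary value outside the
    domain, where sections over the domain are unconstrained. *)
Definition local_frame (t : trivialization E r) (i : 'I_r) (x : M) : E x :=
  xget 0 [set v | triv_map t x v = delta_mx 0 i].

Lemma local_frameP t i x : triv_dom t x ->
  triv_map t x (local_frame t i x) = delta_mx 0 i.
Proof.
move=> tx; have [psi _ psiK] := triv_bij tx.
apply: (@xgetPex _ 0 [set v | triv_map t x v = delta_mx 0 i]).
by exists (psi (delta_mx 0 i)); exact: psiK.
Qed.

Lemma local_frame_smooth t i : @trivs _ _ E t ->
  smooth_section_on (triv_dom t) (local_frame t i).
Proof.
move=> tt s ts j; have [g [sg gE]] := triv_compat tt ts.
rewrite setIC; apply: smooth_on_eq (sg i j).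
  by apply: openI; exact: triv_dom_open.
move=> x [tx sx]; rewrite gE// local_frameP// mxE (bigD1 i)//= mxE !eqxx mul1r.
by rewrite big1 ?addr0// => k /negbTE ki; rewrite mxE ki mul0r.
Qed.

Lemma local_frame_sum t x (v : E x) : triv_dom t x ->
  v = \sum_i triv_map t x v 0 i *: local_frame t i x.
Proof.
move=> tx; apply: (bij_inj (triv_bij tx)); rewrite linear_sum.
rewrite [LHS]row_sum_delta; apply: eq_bigr => i _.
by rewrite linearZ /= local_frameP.
Qed.

(** In a local frame [e] with Gram matrix [G], the coordinate row of
    rho^* df is [w G^-1], where [w] is the row of the rho(e_j)(f); the matrix
    [G] is invertible because the pairing is non-degenerate. *)
Lemma rho_star_smooth (f : smoothFun M) :
  smooth_section_on setT (fun x => rho_star A (differential f x)).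
Proof.
move=> t tt j; rewrite setIT.
have ot : open (triv_dom t) by exact: triv_dom_open.
pose e := local_frame t.
pose G x := \matrix_(i, j) pairing A x (e i x) (e j x).
pose w x := \row_j anchor A x (e j x) f.
have pairE x (u : 'rV_r) k :
    pairing A x (\sum_i u 0 i *: e i x) (e k x) = (u *m G x) 0 k.
  by rewrite linear_sumlz mxE; apply: eq_bigr => i _; rewrite linearZl_LR mxE.
(* A row [k] in the kernel of [G] gives a vector orthogonal to the whole frame,
   hence zero, so [k = 0]. *)
have uG x : triv_dom t x -> G x \in unitmx.
  move=> tx; rewrite -row_free_unit -kermx_eq0; apply/eqP/row_matrixP => i.
  have /row_matrixP/(_ i) := mulmx_ker (G x); rewrite row_mul !row0 => kG.
  set k := row i _ in kG *.
  have k0 : \sum_i k 0 i *: e i x = 0.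
    apply: (pairing_nondegenerate (p := pairing A)) => v.
    rewrite (local_frame_sum v tx) linear_sumr big1// => l _.
    by rewrite linearZr_LR /= pairE kG mxE mulr0.
  transitivity (triv_map t x (\sum_i k 0 i *: e i x)); last first.
    by rewrite k0 linear0.
  rewrite linear_sum [LHS]row_sum_delta.
  by apply: eq_bigr => l _; rewrite linearZ /= local_frameP.
have sG i k : smooth_on (triv_dom t) (fun x => G x i k).
  apply: smooth_on_eq (pairing_smooth (pairing A) ot (local_frame_smooth i tt)
    (local_frame_smooth k tt)) => // x _; by rewrite mxE.
have sw i : smooth_on (triv_dom t) (fun x => w x 0 i).
  apply: smooth_on_eq
    (anchor_smooth (anchor A) ot (local_frame_smooth i tt) f) => // x _.
  by rewrite mxE.
apply: (@smooth_on_eq _ _ _ (fun x => \sum_k w x 0 k * invmx (G x) k j)) => //.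
  move=> x tx; set s : E x := rho_star A _.
  suff -> : triv_map t x s = w x *m invmx (G x) by rewrite mxE.
  rewrite -[LHS](mulmxK (uG x tx)); congr (_ *m _).
  apply/rowP => k; rewrite -pairE -local_frame_sum// rho_starP mxE.
  by [].
apply: smooth_on_sum => // k _; apply: smooth_on_mul => //.
exact: smooth_on_invmx.
Qed.

Definition anchor_dual (f : smoothFun M) : bundleSection E :=
  BundleSection (rho_star_smooth f).

Lemma pairing_anchor_dual f (b : bundleSection E) :
  sec_pairing (anchor_dual f) b = lie_derivative (sec_anchor b) f.
Proof. by apply: smoothFun_eq => x; exact: rho_starP. Qed.

End AnchorDual.

(** * Courant algebroids have no curvature *)

Lemma tangent_eq (R : realType) (M : manifold R) (x : M) (v w : tangent x) :
  (forall f, v f = w f) -> v = w.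
Proof. by move=> vw; apply/val_inj/funext. Qed.

Section CourantFlat.
Variables (R : realType) (M : manifold R) (A : algebroid M).
Local Notation E := (bundle A).
Implicit Types (a b c d : bundleSection E) (f g : smoothFun M).

Lemma sec_pairingDl a b c :
  sec_pairing (a + b) c = sec_pairing a c + sec_pairing b c.
Proof. by apply: smoothFun_eq => x; exact: linearDl. Qed.

Lemma sec_pairingDr a b c :
  sec_pairing a (b + c) = sec_pairing a b + sec_pairing a c.
Proof. by apply: smoothFun_eq => x; exact: linearDr. Qed.

Lemma sec_pairingZl f a b : sec_pairing (f *s a) b = f * sec_pairing a b.
Proof. by apply: smoothFun_eq => x; exact: linearZl_LR. Qed.

Lemma curvatureE a b x f : curvature a b x f =
  (lie_derivative (sec_anchor (bracket a b)) f
   - (lie_derivative (sec_anchor a) (lie_derivative (sec_anchor b) f)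
      - lie_derivative (sec_anchor b) (lie_derivative (sec_anchor a) f))) x.
Proof. by []. Qed.

Lemma lie_derivativeD (X : vectorField M) f g :
  lie_derivative X (f + g) = lie_derivative X f + lie_derivative X g.
Proof. by have := lie_derivativeZ X 1 f g; rewrite !scale1r. Qed.

(** By (Ca2) the derivative of <c,d> along rho(a) is obtained by applying
    [bracket a] to c and to d. Hence F(a,b) acts on <c,d> by applying the
    Jacobiator of a and b to c and to d, and by (Ca3) this is zero. *)
Lemma curvature_pairing a b c d x : Ca2 A -> Ca3 A ->
  curvature a b x (sec_pairing c d) = 0.
Proof.
move=> ca2 ca3; rewrite curvatureE.
rewrite (_ : _ - _ = 0)//; apply/eqP; rewrite subr_eq0; apply/eqP.
rewrite !ca2 !lie_derivativeD !ca2 !(ca3 a b) !sec_pairingDl !sec_pairingDr.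
by ring.
Qed.

(** The product of h = F(a,b)(f) with any pairing is zero, in particular with
    <rho^* dg, d> = rho(d)(g); as h is a combination of such functions,
    h^2 = 0. *)
Lemma courant_curvature0 a b x : Ca2 A -> Ca3 A -> curvature a b x = 0.
Proof.
move=> ca2 ca3; apply: tangent_eq => f; rewrite [RHS]/=.
have ortho c d g : curvature a b x g * sec_pairing c d x = 0.
  have := tangentM (curvature a b x) g (sec_pairing c d).
  by rewrite -sec_pairingZl !curvature_pairing// mulr0 add0r => <-.
have anch d g : curvature a b x f * lie_derivative (sec_anchor d) g x = 0.
  by rewrite -pairing_anchor_dual ortho.
apply/eqP; rewrite -sqrf_eq0 expr2 {2}curvatureE /=.
by rewrite !mulrBr !anch !subr0.
Qed.

End CourantFlat.

(** * Commuting derivatives, and the topology of the Euclidean space *)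

Section Schwarz.
Variables (R : realType) (V : normedModType R).
Implicit Types (f g : V -> R) (u v x : V).

Let shift_quotient f (v w x : V) :
  (fun h => h^-1 *: (((fun y => f (y + w)) \o shift x) (h *: v) - f (x + w))) =
  (fun h => h^-1 *: ((f \o shift (x + w)) (h *: v) - f (x + w))).
Proof. by apply/funext => h /=; rewrite addrA. Qed.

Lemma derive_shiftE f (v w x : V) :
  'D_v (fun y => f (y + w)) x = 'D_v f (x + w).
Proof. by rewrite /derive shift_quotient. Qed.

Lemma derivable_shift f (v w x : V) :
  derivable f (x + w) v -> derivable (fun y => f (y + w)) x v.
Proof. by rewrite /derivable shift_quotient. Qed.

Lemma directional_MVT f u x (h : R) : (forall y, derivable f y u) -> 0 <= h ->
  exists2 s, s \in `[0, h] & f (h *: u + x) - f x = h * 'D_u f (s *: u + x).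
Proof.
move=> df h0; pose phi (t : R) := f (t *: u + x).
have quot (t k : R) : k^-1 *: ((phi \o shift t) (k *: 1) - phi t)
    = k^-1 *: ((f \o shift (t *: u + x)) (k *: u) - f (t *: u + x)).
  by rewrite /phi /= scalerDl -addrA [k%:A]mulr1.
have dphi (t : R) : is_derive t 1 phi ('D_u f (t *: u + x)).
  split.
  - by rewrite /derivable (funext (quot t)); exact: df.
  - by rewrite /derive (funext (quot t)).
have cphi : {within `[0, h], continuous phi}.
  by apply: derivable_within_continuous => t _; exact: ex_derive.
have [s sI E] := MVT_segment h0 (fun t _ => dphi t) cphi.
by exists s => //; move: E; rewrite /phi scale0r add0r subr0 mulrC.
Qed.

(** Two applications of the mean value theorem. The left-hand side is symmetric
    in [u] and [v], which is what makes the derivatives commute. *)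
Lemma second_difference f u v x (h : R) :
  (forall y, derivable f y u) -> (forall y, derivable ('D_u f) y v) -> 0 <= h ->
  exists s t, [/\ s \in `[0, h], t \in `[0, h] &
    f (x + h *: u + h *: v) - f (x + h *: u) - (f (x + h *: v) - f x)
    = h * (h * 'D_v ('D_u f) (x + (s *: u + t *: v)))].
Proof.
move=> du dvu h0; pose g y := f (y + h *: v) - f y.
have dg y : derivable g y u.
  by apply: derivableB => //; exact: derivable_shift.
have [s sI gE] := directional_MVT x dg h0.
have [t tI fE] := directional_MVT (s *: u + x) dvu h0.
exists s, t; split=> //.
have -> : x + (s *: u + t *: v) = t *: v + (s *: u + x).
  by rewrite addrA addrC (addrC x).
rewrite -fE [X in 'D_u f X - _]addrC -derive_shiftE -deriveB//.
  by rewrite -gE /g (addrC x (h *: u)).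
exact: derivable_shift.
Qed.

Lemma continuous_near_parallelogram f u v x (e : R) :
  {for x, continuous f} -> 0 < e ->
  exists2 d : R, 0 < d &
    forall h s t, 0 < h <= d -> s \in `[0, h] -> t \in `[0, h] ->
    `|f (x + (s *: u + t *: v)) - f x| < e.
Proof.
move=> cf e0; have /cvgr_dist_lt/(_ e e0) := cf.
move=> /nbhs_ballP[d /= d0 dP].
pose N := `|u| + `|v| + 1.
have N0 : 0 < N by rewrite ltr_wpDl// addr_ge0.
exists (d / N); first by rewrite divr_gt0.
move=> h s t /andP[h0 hd]; rewrite !in_itv /= => /andP[s0 sh] /andP[t0 th].
rewrite distrC; apply: dP; rewrite -ball_normE /= opprD addNKr normrN.
apply: le_lt_trans (ler_normD _ _) _; rewrite !normrZ !ger0_norm//.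
have hN : h * N <= d by rewrite -ler_pdivlMr.
apply: lt_le_trans hN.
have : h * (`|u| + `|v|) < h * N by rewrite ltr_pM2l// ltrDl.
by apply: le_lt_trans; rewrite mulrDr lerD// ler_wpM2r.
Qed.

(** For small [h], the second difference over the parallelogram with sides
    [h *: u] and [h *: v], divided by [h ^+ 2], is close to both mixed
    derivatives at [x]. *)
Lemma derive_comm f u v x :
  (forall y, derivable f y u) -> (forall y, derivable f y v) ->
  (forall y, derivable ('D_u f) y v) -> (forall y, derivable ('D_v f) y u) ->
  {for x, continuous ('D_v ('D_u f))} -> {for x, continuous ('D_u ('D_v f))} ->
  'D_v ('D_u f) x = 'D_u ('D_v f) x.
Proof.
move=> du dv duv dvu cuv cvu; apply/eqP; rewrite -subr_eq0 -normr_le0.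
apply/ler_addgt0Pl => e e0; rewrite addr0.
have e2 : 0 < e / 2 by rewrite divr_gt0.
have [d1 d10 d1P] := continuous_near_parallelogram u v cuv e2.
have [d2 d20 d2P] := continuous_near_parallelogram v u cvu e2.
pose h := Num.min d1 d2.
have h0 : 0 < h by rewrite lt_min d10.
have hd1 : 0 < h <= d1 by rewrite h0 ge_min lexx.
have hd2 : 0 < h <= d2 by rewrite h0 ge_min lexx orbT.
have [s [t [sI tI E1]]] := second_difference x du duv (ltW h0).
have [t' [s' [t'I s'I E2]]] := second_difference x dv dvu (ltW h0).
have E : 'D_v ('D_u f) (x + (s *: u + t *: v)) =
         'D_u ('D_v f) (x + (t' *: v + s' *: u)).
  do 2 apply: (mulfI (lt0r_neq0 h0)).
  apply: etrans (esym E1) _; apply: etrans E2; rewrite [x + h *: v + _]addrAC.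
  have swap (a b c d' : R) : a - b - (c - d') = a - c - (b - d') by ring.
  exact: swap.
move: E (d1P _ _ _ hd1 sI tI) (d2P _ _ _ hd2 t'I s'I).
generalize ('D_v ('D_u f) x) ('D_u ('D_v f) x)
  ('D_v ('D_u f) (x + (s *: u + t *: v)))
  ('D_u ('D_v f) (x + (t' *: v + s' *: u))) => p q p' q' -> pq qq.
have := ltrD pq qq; rewrite -splitr distrC => /ltW; apply: le_trans.
by apply: le_trans (ler_normD _ _); rewrite addrA subrK.
Qed.

End Schwarz.

Section EuclideanSpace.
Variables (R : realType) (n : nat).
Local Notation X := 'rV[R]_n.

(** The balls with rational centre and radius 1/(k+1) form a basis. *)
Lemma rV_second_countable : @second_countable X.
Proof.
pose B : set (set X) := range (fun p : 'rV[rat]_n * nat =>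
  ball (map_mx ratr p.1 : X) p.2.+1%:R^-1).
exists B; first exact: card_le_trans (card_image_le _ _) (countableP _).
split=> [_ [p _ <-]|x U /= nU]; first exact: ball_open.
have /nbhs_ballP[e /= e0 eU] := nU.
have [k ke] : exists k : nat, k.+1%:R^-1 < e / 2.
  have [k] := ltr_add_invr (divr_gt0 e0 (ltr0n R 2)).
  by rewrite add0r; exists k.
have k0 : 0 < k.+1%:R^-1 :> R by rewrite invr_gt0.
have rat_near (y : R) : {q : rat | `|ratr q - y| < k.+1%:R^-1}.
  apply: cid; have /rat_in_itvoo[q] : y - k.+1%:R^-1 < y + k.+1%:R^-1.
    by rewrite ltrD2l gtrN.
  by rewrite in_itv /= => qI; exists q; rewrite ltr_distl.
pose q : 'rV[rat]_n := \row_j sval (rat_near (x 0 j)).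
have qx : ball (map_mx ratr q : X) k.+1%:R^-1 x.
  split=> // i j; rewrite !mxE (ord1 i) -ball_normE /=.
  exact: svalP (rat_near _).
exists (ball (map_mx ratr q : X) k.+1%:R^-1).
  by split=> //; exists (q, k).
move=> y qy; apply: eU.
apply: (@le_ball _ _ _ (k.+1%:R^-1 + k.+1%:R^-1)).
  by rewrite (splitr e) lerD// ltW.
exact: ball_triangle (ball_sym qx) qy.
Qed.

End EuclideanSpace.

(** * The Euclidean space as a manifold *)

Section Euclidean.
Variables (R : realType) (n : nat).
Local Notation X := 'rV[R]_n.

Lemma coord_is_derive (i : 'I_n) (v x : X) :
  is_derive x v (fun y : X => y 0 i) (v 0 i).
Proof.
suff c : (fun h : R =>
    h^-1 *: (((fun y : X => y 0 i) \o shift x) (h *: v) - x 0 i)) @ 0^'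
    --> v 0 i.
  by split; [apply/cvg_ex; exists (v 0 i)|exact/cvg_lim].
apply: cvg_near_cst; near=> h.
rewrite /= !mxE addrK /GRing.scale /= mulKf//.
by near: h; exact: nbhs_dnbhs_neq.
Unshelve. all: by end_near. Qed.

Lemma Cinf_coord (U : set X) (i : 'I_n) : Cinf_on U (fun y => y 0 i).
Proof.
have cc : continuous (fun y : X => y 0 i) by exact: coord_continuous.
case=> [|k]; first by split=> // x _; exact: cc.
split=> [x _|j]; first exact: cc.
split=> [x _|]; first by have [] := coord_is_derive i (delta_mx 0 j) x.
rewrite (_ : 'D__ _ = cst ((delta_mx 0 j : X) 0 i)); first exact: Ck_cst.
by apply/funext => x; have [_ ->] := coord_is_derive i (delta_mx 0 j) x.
Qed.

Let open_id_image : open (id @` [set: X]).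
Proof. by rewrite image_id; exact: openT. Qed.

Definition euclidean_chart : chart R n X :=
  @Chart R n X setT id id openT open_id_image (fun _ _ => erefl)
    (fun _ _ => cvg_id) (fun _ _ => cvg_id).

Let euclidean_cover (x : X) :
  exists2 c, [set euclidean_chart] c & chart_dom c x.
Proof. by exists euclidean_chart. Qed.

Let euclidean_compat c d : [set euclidean_chart] c -> [set euclidean_chart] d ->
  forall i : 'I_n, Cinf_on (chart_map c @` (chart_dom c `&` chart_dom d))
    (fun y => chart_map d (chart_inv c y) 0 i).
Proof. by move=> -> -> i; exact: Cinf_coord. Qed.

Definition euclidean : manifold R :=
  @Manifold R X n (@norm_hausdorff _ _) (@rV_second_countable R n) _
    euclidean_cover euclidean_compat.

Local Notation M := euclidean.
Local Notation C := (smoothFun M).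

Lemma smooth_onE (U : set M) (f : M -> R) :
  smooth_on U f <-> Cinf_on (U : set X) f.
Proof.
rewrite /smooth_on; split=> [/(_ euclidean_chart erefl)|sf c ->] /=;
  by rewrite setTI image_id.
Qed.

Definition coordinate (i : 'I_n) : C :=
  mk_smooth (iffRL (smooth_onE setT _) (Cinf_coord setT i)).

Lemma smooth_on_partial (U : set M) (f : M -> R) i : smooth_on U f ->
  smooth_on U ('D_(delta_mx 0 i) (f : X -> R)).
Proof.
by move=> /smooth_onE sf; apply/smooth_onE => k; have [_ /(_ i)[]] := sf k.+1.
Qed.

Lemma smooth_derivable (f : C) i (x : X) :
  derivable (f : X -> R) x (delta_mx 0 i).
Proof. by have /smooth_onE/(_ 1%N)[_ /(_ i)[+ _]] := smoothFunP f; exact. Qed.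

Definition partial (i : 'I_n) (f : C) : C :=
  mk_smooth (smooth_on_partial i (smoothFunP f)).

Lemma partial_is_linear i : linear (partial i).
Proof.
move=> k f g; apply: smoothFun_eq => x.
transitivity ('D_(delta_mx 0 i) ((k \*: (f : X -> R)) \+ (g : X -> R)) x) => //.
rewrite deriveD;
  [|by apply: derivableZ; exact: smooth_derivable..|exact: smooth_derivable].
by rewrite deriveZ//; exact: smooth_derivable.
Qed.
HB.instance Definition _ i :=
  GRing.isLinear.Build R C C *:%R (partial i) (@partial_is_linear i).

Lemma partialM i (f g : C) :
  partial i (f * g) = f * partial i g + partial i f * g.
Proof.
apply: smoothFun_eq => x.
transitivity ('D_(delta_mx 0 i) ((f : X -> R) \* (g : X -> R)) x) => //.
rewrite deriveM; [|exact: smooth_derivable..].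
by rewrite /GRing.scale /= [X in _ + X]mulrC.
Qed.

Lemma partialC i j (f : C) : partial i (partial j f) = partial j (partial i f).
Proof.
apply: smoothFun_eq => x; apply: derive_comm => [y|y|y|y||].
- exact: smooth_derivable.
- exact: smooth_derivable.
- exact: (@smooth_derivable (partial j f)).
- exact: (@smooth_derivable (partial i f)).
- have /smooth_onE/(_ 0%N)[+ _] := smoothFunP (partial i (partial j f)).
  exact.
- have /smooth_onE/(_ 0%N)[+ _] := smoothFunP (partial j (partial i f)).
  exact.
Qed.

Lemma partial_coordinate i j : partial i (coordinate j) = (i == j)%:R.
Proof.
apply: smoothFun_eq => x /=.
have [_ ->] := coord_is_derive j (delta_mx 0 i) x.
by rewrite mxE eqxx eq_sym; case: eqP.
Qed.

Lemma partial_at_der i (x : M) : (fun f => partial i f x) \in derivation_at x.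
Proof.
by rewrite inE; split=> [k f g|f g]; rewrite ?linearP ?partialM.
Qed.

Definition partial_at i (x : M) : tangent x := Tangent (partial_at_der i x).

Definition gradient (f : C) (x : M) : 'rV[R]_n := \row_i partial i f x.

Definition vector_at (x : M) (u : 'rV[R]_n) : tangent x :=
  \sum_i u 0 i *: partial_at i x.

Lemma vector_atE (x : M) u f : vector_at x u f = (u *m (gradient f x)^T) 0 0.
Proof.
rewrite mxE.
have -> : vector_at x u f = \sum_i (u 0 i *: partial_at i x : tangent x) f.
  rewrite /vector_at; elim/big_ind2 : _ => // v1 f1 v2 f2 <- <-.
  by [].
by apply: eq_bigr => i _; rewrite !mxE.
Qed.

Lemma vector_at_is_linear x : linear (vector_at x).
Proof.
move=> k u v; apply: tangent_eq => f.
have -> : (k *: vector_at x u + vector_at x v : tangent x) f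
  = k * vector_at x u f + vector_at x v f by [].
by rewrite !vector_atE mulmxDl -scalemxAl !mxE.
Qed.

HB.instance Definition _ x := GRing.isLinear.Build R 'rV[R]_n (tangent x) *:%R
  (vector_at x) (@vector_at_is_linear x).

(** The coordinate functions recover the components of the vector. *)
Lemma vector_at_eq0 x u : vector_at x u = 0 -> u = 0.
Proof.
move=> u0; apply/rowP => j; rewrite mxE.
have : vector_at x u (coordinate j) = 0 by rewrite u0.
rewrite vector_atE mxE => <-.
rewrite (bigD1 j)//= big1 => [|i /negbTE ij]; rewrite !mxE partial_coordinate.
  by rewrite eqxx mulr1 addr0.
by rewrite ij mulr0.
Qed.

End Euclidean.

(** * Smooth matrices, and vector products given by trivectors *)

Section SmoothMatrices.
Variables (R : realType) (M : manifold R).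

Definition smooth_mx m p (U : set M) (A : M -> 'M[R]_(m, p)) : Prop :=
  forall i j, smooth_on U (fun x => A x i j).

Lemma smooth_mx_cst m p U (A : 'M[R]_(m, p)) : smooth_mx U (fun=> A).
Proof. by move=> i j; exact: smooth_on_cst. Qed.

Lemma smooth_mx_add m p (U : set M) (A B : M -> 'M[R]_(m, p)) : open U ->
  smooth_mx U A -> smooth_mx U B -> smooth_mx U (fun x => A x + B x).
Proof.
move=> oU sA sB i j.
apply: smooth_on_eq (smooth_on_add oU (sA i j) (sB i j)) => //.
by move=> x _; rewrite mxE.
Qed.

Lemma smooth_mx_scale m p (U : set M) (f : M -> R) (A : M -> 'M[R]_(m, p)) :
  open U -> smooth_on U f -> smooth_mx U A -> smooth_mx U (fun x => f x *: A x).
Proof.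
move=> oU sf sA i j; apply: smooth_on_eq (smooth_on_mul oU sf (sA i j)) => //.
by move=> x _; rewrite mxE.
Qed.

Lemma smooth_mx_tr m p (U : set M) (A : M -> 'M[R]_(m, p)) : open U ->
  smooth_mx U A -> smooth_mx U (fun x => (A x)^T).
Proof.
by move=> oU sA i j; apply: smooth_on_eq (sA j i) => // x _; rewrite mxE.
Qed.

Lemma smooth_mx_mul m p q (U : set M) (A : M -> 'M[R]_(m, p))
    (B : M -> 'M[R]_(p, q)) : open U ->
  smooth_mx U A -> smooth_mx U B -> smooth_mx U (fun x => A x *m B x).
Proof.
move=> oU sA sB i j.
apply: (@smooth_on_eq _ _ _ (fun x => \sum_k A x i k * B x k j)) => //.
  by move=> x _; rewrite mxE.
by apply: smooth_on_sum => // k _; apply: smooth_on_mul.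
Qed.

End SmoothMatrices.

Section Trivectors.
Variables (R : comNzRingType) (r : nat) (S : 'M[R]_r).
Local Notation V := 'rV[R]_r.
Implicit Types (u v w : V) (T : seq (V * V * V)).

Definition inner u v : R := (u *m S *m v^T) 0 0.

Lemma inner_linearl v : scalar (inner^~ v).
Proof. by move=> k u u'; rewrite /inner !mulmxDl -!scalemxAl !mxE. Qed.

Lemma inner_linearr u : scalar (inner u).
Proof. by move=> k v v'; rewrite /inner linearP mulmxDr -scalemxAr !mxE. Qed.

Lemma inner0l v : inner 0 v = 0.
Proof. by rewrite /inner !mul0mx mxE. Qed.

Lemma innerDl u u' v : inner (u + u') v = inner u v + inner u' v.
Proof. by have := inner_linearl v 1 u u'; rewrite scale1r mul1r. Qed.

Lemma innerZl k u v : inner (k *: u) v = k * inner u v.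
Proof. by have := inner_linearl v k u 0; rewrite !addr0 inner0l addr0. Qed.

(** The vector T(u,v) with <T(u,v), w> = T(u,v,w), where T is the decomposable
    trivector of the triple [t], seen as a 3-form through the metric: T(u,v,w)
    is the determinant of the pairings of the entries of [t] with u, v, w. *)
Definition simple_flux (t : V * V * V) u v : V :=
  (inner t.1.1 u * inner t.1.2 v - inner t.1.2 u * inner t.1.1 v) *: t.2 +
  (inner t.1.2 u * inner t.2 v - inner t.2 u * inner t.1.2 v) *: t.1.1 +
  (inner t.2 u * inner t.1.1 v - inner t.1.1 u * inner t.2 v) *: t.1.2.

(** Every trivector is a sum of decomposable ones. *)
Definition flux T u v : V := \sum_(t <- T) simple_flux t u v.

Lemma flux_skew T u v : flux T u v = - flux T v u.
Proof.
rewrite /flux -sumrN; apply: eq_bigr => t _.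
rewrite /simple_flux !opprD -!scaleNr.
by congr (_ *: _ + _ *: _ + _ *: _); ring.
Qed.

Lemma flux_linearl T v : linear (flux T ^~ v).
Proof.
move=> k u u'; rewrite /flux scaler_sumr -big_split; apply: eq_bigr => t _.
rewrite /simple_flux !inner_linearr !scalerDr !scalerA.
rewrite [RHS]addrACA [in X in _ = X + _]addrACA -!scalerDl.
by congr (_ *: _ + _ *: _ + _ *: _); ring.
Qed.

Hypothesis S_sym : S^T = S.

Lemma innerC u v : inner u v = inner v u.
Proof.
transitivity ((v *m S *m u^T)^T 0 0); last by rewrite mxE.
by rewrite !trmx_mul trmxK S_sym mulmxA.
Qed.

(** Total skew-symmetry of the 3-form, in the shape that (Ca2) requires. *)
Lemma flux_inner T u v w :
  inner (flux T u v) w + inner (flux T u w) v = 0.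
Proof.
have sumE v' w' :
    inner (flux T u v') w' = \sum_(t <- T) inner (simple_flux t u v') w'.
  rewrite /flux; apply: (big_morph (inner^~ w')); last exact: inner0l.
  by move=> ? ?; exact: innerDl.
rewrite !sumE -big_split big1//= => t _.
by rewrite /simple_flux !innerDl !innerZl; ring.
Qed.

End Trivectors.

(** * Trivial bundles over the Euclidean space *)

Section FlatBundle.
Variables (R : realType) (n r : nat).
Local Notation M := (euclidean R n).
Local Notation C := (smoothFun M).

Let triv_fiber : M -> lmodType R := fun=> 'rV[R]_r.

Definition global_triv : trivialization triv_fiber r :=
  @Trivialization R M triv_fiber r setT (fun=> idfun) openT
    (fun _ _ => Bijective (fun=> erefl) (fun=> erefl)).

Let global_triv_cover (x : M) :
  exists2 t, [set global_triv] t & triv_dom t x.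
Proof. by exists global_triv. Qed.

Let global_triv_compat s t : [set global_triv] s -> [set global_triv] t ->
  exists g : M -> 'M[R]_r,
    (forall i j, smooth_on (triv_dom s `&` triv_dom t) (fun x => g x i j)) /\
    (forall x, (triv_dom s `&` triv_dom t) x ->
      forall v, triv_map t x v = triv_map s x v *m g x).
Proof.
move=> -> ->; exists (fun=> 1%:M); split=> [i j|x _ v]; last by rewrite mulmx1.
exact: smooth_on_cst.
Qed.

Definition trivial_bundle : vectorBundle M :=
  VectorBundle global_triv_cover global_triv_compat.

Local Notation E := trivial_bundle.

(** The identification of a fibre with the space of rows, made explicit so that
    matrix products apply to values of sections. *)
Definition vec (a : forall x, E x) (x : M) : 'rV[R]_r := a x.

Lemma smooth_sectionE (U : set M) (a : forall x, E x) :
  smooth_section_on U a <-> smooth_mx U (vec a).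
Proof.
split=> [sa i j|sa t -> j]; last by rewrite /= setTI; exact: sa.
by rewrite (ord1 i); have := sa _ erefl j; rewrite /= setTI.
Qed.

Definition mk_section (a : M -> 'rV[R]_r) (sa : smooth_mx setT a) :
  bundleSection E := BundleSection (iffRL (smooth_sectionE setT a) sa).

Lemma section_smooth_mx (a : bundleSection E) : smooth_mx setT (vec a).
Proof. exact/smooth_sectionE/section_smooth. Qed.

Definition constant_section (u : 'rV[R]_r) : bundleSection E :=
  mk_section (smooth_mx_cst setT u).

Definition component (a : bundleSection E) (j : 'I_r) : C :=
  mk_smooth (section_smooth_mx a 0 j).

End FlatBundle.

Section Jacobians.
Variables (R : realType) (n : nat).
Local Notation M := (euclidean R n).
Local Notation C := (smoothFun M).

Definition values r (u : 'I_r -> C) (x : M) : 'rV[R]_r := \row_j u j x.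

Definition jacobian_matrix r (u : 'I_r -> C) (x : M) : 'M[R]_(n, r) :=
  \matrix_(i, j) partial i (u j) x.

Lemma jacobian_smooth r (u : 'I_r -> C) : smooth_mx setT (jacobian_matrix u).
Proof.
move=> i j; apply: smooth_on_eq (smoothFunP (partial i (u j))).
  exact: openT.
by move=> x _; rewrite mxE.
Qed.

Lemma smoothFun_sum (I : Type) (s : seq I) (F : I -> C) x :
  (\sum_(i <- s) F i) x = \sum_(i <- s) F i x.
Proof. by apply: (big_morph (fun f : C => f x)). Qed.

Lemma jacobian_linear r (u v w : 'I_r -> C) k x :
  (forall j, w j = k *: u j + v j) ->
  jacobian_matrix w x = k *: jacobian_matrix u x + jacobian_matrix v x.
Proof. by move=> wE; apply/matrixP => i j; rewrite !mxE wE linearP. Qed.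

(** The Leibniz rule for a bilinear expression u Q w^T. It applies to the
    pairing of two sections (Q is the metric) and to the derivative of a
    function along a section (Q is the anchor and w the gradient). *)
Lemma gradient_bilinear r m (u : 'I_r -> C) (w : 'I_m -> C) (Q : 'M[R]_(r, m))
    (h : C) x :
  (forall y, h y = (values u y *m Q *m (values w y)^T) 0 0) ->
  gradient h x = values w x *m Q^T *m (jacobian_matrix u x)^T
               + values u x *m Q *m (jacobian_matrix w x)^T.
Proof.
move=> hE; have -> : h = \sum_k (\sum_l Q l k *: u l) * w k.
  apply: smoothFun_eq => y; rewrite hE mxE smoothFun_sum.
  apply: eq_bigr => k _; rewrite !mxE.
  have -> : ((\sum_l Q l k *: u l) * w k) y =
    (\sum_l Q l k *: u l) y * w k y by [].
  rewrite smoothFun_sum; congr (_ * _); apply: eq_bigr => l _.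
  by rewrite mxE mulrC.
have sumE (z : 'I_r -> C) k : (\sum_l Q l k *: z l) x = (values z x *m Q) 0 k.
  rewrite smoothFun_sum mxE; apply: eq_bigr => l _.
  by rewrite mxE mulrC.
have partial_sum i (I : Type) (s : seq I) (F : I -> C) :
    partial i (\sum_(l <- s) F l) = \sum_(l <- s) partial i (F l).
  exact: linear_sum.
have partialZ i (c : R) (f : C) : partial i (c *: f) = c *: partial i f.
  exact: linearZ.
apply/rowP => i; rewrite mxE partial_sum smoothFun_sum.
transitivity (\sum_k ((values u x *m Q) 0 k * partial i (w k) x
  + (\sum_l Q l k * partial i (u l) x) * w k x)).
  apply: eq_bigr => k _; rewrite partialM.
  have eval (f g f' g' : C) :
    (f * g + f' * g') x = f x * g x + f' x * g' x by [].
  rewrite eval sumE partial_sum smoothFun_sum; congr (_ + _ * _).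
  by apply: eq_bigr => l _; rewrite partialZ.
rewrite big_split /= addrC mxE; congr (_ + _); last first.
  by rewrite mxE; apply: eq_bigr => k _; congr (_ * _); rewrite !mxE.
under eq_bigr do rewrite mulr_suml.
rewrite exchange_big mxE; apply: eq_bigr => l _ /=.
rewrite mxE mulr_suml; apply: eq_bigr => k _; rewrite !mxE.
by rewrite mulrC mulrA.
Qed.

End Jacobians.

(** * Metric algebroids with constant coefficients *)

(** The metric is <u,v> = u S v^T and the anchor sends u to u N. Every
    non-degenerate symmetric form has a basis in which S^2 = 1, and then the
    dual rho^* of the anchor sends w to w N^T S. *)
Section ConstantAlgebroid.
Variables (R : realType) (n r : nat) (S : 'M[R]_r) (N : 'M[R]_(r, n)).
Variable T : seq ('rV[R]_r * 'rV[R]_r * 'rV[R]_r).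
Hypotheses (S_sym : S^T = S) (S_invol : S *m S = 1%:M).
Local Notation M := (euclidean R n).
Local Notation C := (smoothFun M).
Local Notation E := (trivial_bundle R n r).
Local Notation inner := (inner S).
Implicit Types (a b c : bundleSection E) (f : C).

Let S_pairing (x : M) : E x -> E x -> R := fun u v => inner u v.

Let S_pairing_bilinear x : bilinear_for
  (GRing.Scale.Law.clone _ _ *%R _) (GRing.Scale.Law.clone _ _ *%R _)
  (@S_pairing x).
Proof.
by split=> u k v w; [exact: inner_linearl|exact: inner_linearr].
Qed.

HB.instance Definition _ x := bilinear_isBilinear.Build R (E x) (E x) R _ _
  (@S_pairing x) (S_pairing_bilinear x).

Let S_pairing_sym x (u v : E x) : S_pairing u v = S_pairing v u.
Proof. exact: innerC. Qed.

Let S_pairing_nondegenerate x (u : E x) :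
  (forall v, S_pairing u v = 0) -> u = 0.
Proof.
move=> u0; have uS : (u : 'rV[R]_r) *m S = 0.
  apply/rowP => j; rewrite [RHS]mxE -(u0 (delta_mx 0 j)) /S_pairing /inner.
  by rewrite trmx_delta -colE [RHS]mxE.
by rewrite -[LHS](mulmx1 (u : 'rV[R]_r)) -S_invol mulmxA uS mul0mx.
Qed.

Lemma smooth_on_inner (U : set M) (a b : M -> 'rV[R]_r) : open U ->
  smooth_mx U a -> smooth_mx U b -> smooth_on U (fun x => inner (a x) (b x)).
Proof.
move=> oU sa sb; apply: smooth_mx_mul => //; last exact: smooth_mx_tr.
by apply: smooth_mx_mul => //; exact: smooth_mx_cst.
Qed.

Let S_pairing_smooth (U : set M) (a b : forall x, E x) : open U ->
  smooth_section_on U a -> smooth_section_on U b ->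
  smooth_on U (fun x => S_pairing (a x) (b x)).
Proof.
by move=> oU /smooth_sectionE sa /smooth_sectionE sb; exact: smooth_on_inner.
Qed.

Definition constant_metric : pseudoMetric E :=
  @Defs.PseudoMetric R M E (fun x => @S_pairing x) S_pairing_sym
    S_pairing_nondegenerate S_pairing_smooth.

Let N_anchor (x : M) (u : E x) : tangent x := vector_at x ((u : 'rV[R]_r) *m N).

Let N_anchor_linear x : linear (@N_anchor x).
Proof.
by move=> k u v; rewrite /N_anchor mulmxDl -scalemxAl linearP.
Qed.
HB.instance Definition _ x := GRing.isLinear.Build R (E x) (tangent x) *:%R
  (@N_anchor x) (@N_anchor_linear x).

Lemma gradient_smooth f : smooth_mx setT (gradient f).
Proof.
move=> i j; apply: smooth_on_eq (smoothFunP (partial j f)); first exact: openT.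
by move=> x _; rewrite mxE.
Qed.

Let N_anchor_smooth (U : set M) (a : forall x, E x) : open U ->
  smooth_section_on U a ->
  forall f, smooth_on U (fun x => N_anchor (a x) f).
Proof.
move=> oU /smooth_sectionE sa f.
apply: (@smooth_on_eq _ _ _
  (fun x => (vec a x *m N *m (gradient f x)^T) 0 0)) => //.
  by move=> x _; rewrite /N_anchor vector_atE.
have sg : smooth_mx U (gradient f).
  by move=> i j; apply: smooth_on_sub (gradient_smooth f i j).
apply: smooth_mx_mul => //; last exact: smooth_mx_tr.
by apply: smooth_mx_mul => //; exact: smooth_mx_cst.
Qed.

Definition constant_anchor : anchorMap E :=
  @AnchorMap R M E (fun x => @N_anchor x) N_anchor_smooth.

Local Notation J a := (jacobian_matrix (component a)).

(** The terms are D_(rho a) b, D_(rho b) a, rho^* <D a, b> and T(a,b). Without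
    T this is the flat Dorfman bracket when the bundle is TM + T^*M. *)
Definition bracket_value a b (x : M) : 'rV[R]_r :=
  vec a x *m N *m J b x - vec b x *m N *m J a x
  + vec b x *m S *m (J a x)^T *m N^T *m S + flux S T (vec a x) (vec b x).

Lemma flux_smooth (a b : M -> 'rV[R]_r) :
  smooth_mx setT a -> smooth_mx setT b ->
  smooth_mx setT (fun x => flux S T (a x) (b x)).
Proof.
move=> sa sb i j; apply: (@smooth_on_eq _ _ _
  (fun x => \sum_(t <- T) simple_flux S t (a x) (b x) i j)); first exact: openT.
  by move=> x _; rewrite summxE.
apply: smooth_on_sum => [|t _]; first exact: openT.
have sc p (d : M -> 'rV[R]_r) :
    smooth_mx setT d -> smooth_on setT (fun x => inner p (d x)).
  by move=> sd; apply: smooth_on_inner (smooth_mx_cst _ p) sd; exact: openT.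
have minor p q s : smooth_mx setT
    (fun x => (inner p (a x) * inner q (b x)
      - inner q (a x) * inner p (b x)) *: s).
  apply: smooth_mx_scale (smooth_mx_cst _ s); first exact: openT.
  exact: (smoothFunP (mk_smooth (sc p a sa) * mk_smooth (sc q b sb) -
    mk_smooth (sc q a sa) * mk_smooth (sc p b sb))).
by do 2 ?[apply: smooth_mx_add; first exact: openT]; exact: minor.
Qed.

Lemma bracket_smooth a b : smooth_mx setT (bracket_value a b).
Proof.
have sJ c : smooth_mx setT (J c) by exact: jacobian_smooth.
have sv c : smooth_mx setT (vec c) by exact: section_smooth_mx.
have mulT m p q (A : M -> 'M[R]_(m, p)) (B : M -> 'M[R]_(p, q)) :
    smooth_mx setT A -> smooth_mx setT B ->
    smooth_mx setT (fun x => A x *m B x).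
  by move=> sA sB; apply: smooth_mx_mul => //; exact: openT.
have oT := @openT M.
apply: smooth_mx_add => //; last exact: flux_smooth.
apply: smooth_mx_add => //; last first.
  do 2 apply: (mulT _ _ _ _ _ _ (smooth_mx_cst _ _)).
  apply: (mulT _ _ _ _ _ (mulT _ _ _ _ _ (sv b) (smooth_mx_cst _ S))).
  exact: smooth_mx_tr.
have sub A B : smooth_mx setT A -> smooth_mx setT B ->
    smooth_mx setT (fun x : M => A x - B x :> 'rV[R]_r).
  move=> sA sB i j.
  apply: smooth_on_eq
    (smoothFunP (mk_smooth (sA i j) - mk_smooth (sB i j))) => //.
  by move=> x _; rewrite !mxE.
have svN c := mulT _ _ _ _ _ (sv c) (smooth_mx_cst _ N).
by apply: sub; exact: (mulT _ _ _ _ _ (svN _) (sJ _)).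
Qed.

Definition constant_bracket a b : bundleSection E :=
  mk_section (bracket_smooth a b).

Lemma component_linear k a b x : J (k *: a + b) x = k *: J a x + J b x.
Proof.
apply: jacobian_linear => j; apply: smoothFun_eq => y /=.
by rewrite /vec /= !mxE.
Qed.

Let regroup (k : R) (p p' q q' s s' t t' : 'rV[R]_r) :
  k *: p + p' - (k *: q + q') + (k *: s + s') + (k *: t + t')
  = k *: (p - q + s + t) + (p' - q' + s' + t').
Proof. by apply/rowP => j; rewrite !mxE; ring. Qed.

Lemma flux_linearr u : linear (flux S T u).
Proof.
move=> k v w; rewrite ![flux S T u _]flux_skew flux_linearl opprD scalerN.
by [].
Qed.

Lemma flux0r u : flux S T u 0 = 0.
Proof.
by have := flux_linearr u (-1) 0 0; rewrite scaler0 addr0 scaleN1r addNr.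
Qed.

Lemma constant_bracket_linear_r a : linear (constant_bracket a).
Proof.
move=> k b c; apply: section_eq => x.
rewrite [LHS]/= /bracket_value component_linear.
rewrite (_ : vec (k *: b + c) x = k *: vec b x + vec c x)// flux_linearr.
by rewrite !(mulmxDl, mulmxDr) -!scalemxAr -!scalemxAl regroup.
Qed.

Lemma constant_bracket_linear_l b : linear (constant_bracket^~ b).
Proof.
move=> k a c; apply: section_eq => x.
rewrite [LHS]/= /bracket_value component_linear.
rewrite (_ : vec (k *: a + c) x = k *: vec a x + vec c x)// flux_linearl.
rewrite [(_ + _)^T]linearP /=.
by rewrite !(mulmxDl, mulmxDr) -!scalemxAr -!scalemxAl regroup.
Qed.

Definition constant_algebroid : algebroid M :=
  @Algebroid R M E constant_metric constant_anchor constant_bracket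
    constant_bracket_linear_r constant_bracket_linear_l.

Local Notation A := constant_algebroid.

Lemma values_component a x : values (component a) x = vec a x.
Proof. by apply/rowP => j; rewrite mxE. Qed.

Lemma lie_derivative_anchorE a f x :
  lie_derivative (sec_anchor (A := A) a) f x =
  (vec a x *m N *m (gradient f x)^T) 0 0.
Proof. exact: vector_atE. Qed.

Lemma gradient_pairing a b x : gradient (sec_pairing (A := A) a b) x =
  vec b x *m S *m (J a x)^T + vec a x *m S *m (J b x)^T.
Proof.
rewrite (gradient_bilinear (u := component a) (w := component b) (Q := S)).
  by rewrite S_sym !values_component.
by move=> y; rewrite !values_component.
Qed.

Definition hessian f x : 'M[R]_n := jacobian_matrix (fun i => partial i f) x.

Lemma hessian_sym f x : (hessian f x)^T = hessian f x.
Proof. by apply/matrixP => i j; rewrite !mxE partialC. Qed.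

Lemma gradient_lie_derivative b f x :
  gradient (lie_derivative (sec_anchor (A := A) b) f) x =
  gradient f x *m N^T *m (J b x)^T + vec b x *m N *m hessian f x.
Proof.
rewrite (gradient_bilinear (u := component b) (w := fun i => partial i f)
  (Q := N)).
  by rewrite -/(hessian f x) hessian_sym !values_component.
by move=> y; rewrite lie_derivative_anchorE values_component.
Qed.

Let inner11 (u v : 'rV[R]_r) : inner u v = (u *m S *m v^T) 0 0.
Proof. by []. Qed.

Let tr11 (B : 'M[R]_1) : B^T 0 0 = B 0 0.
Proof. by rewrite mxE. Qed.

Let add11 (B D : 'M[R]_1) : (B + D) 0 0 = B 0 0 + D 0 0.
Proof. by rewrite mxE. Qed.

Let opp11 (B : 'M[R]_1) : (- B) 0 0 = - B 0 0.
Proof. by rewrite mxE. Qed.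

Let symmetrize (p q s s' t : 'rV[R]_r) :
  p - q + s + t + (q - p + s' - t) = s + s'.
Proof. by apply/rowP => j; rewrite !mxE; ring. Qed.

(** The first two terms of the bracket and the flux are skew, and the third one
    symmetrizes to rho^* of the gradient of <a,b>. *)
Lemma constant_Ca1 : Ca1 A.
Proof.
move=> a b x; change (bundleSection E) in a, b; apply: rho_star_unique => c.
change ('rV[R]_r) in c.
transitivity ((c *m N *m (gradient (sec_pairing (A := A) a b) x)^T) 0 0);
  last by rewrite -vector_atE.
have -> : (bracket (a : bundleSection (bundle A)) b
    + bracket (b : bundleSection (bundle A)) a) x
    = (vec b x *m S *m (J a x)^T + vec a x *m S *m (J b x)^T) *m N^T *m S
    :> 'rV[R]_r.
  rewrite -[LHS]/(bracket_value a b x + bracket_value b a x) /bracket_value.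
  rewrite (flux_skew S T (vec b x)) !mulmxDl.
  exact: symmetrize.
rewrite gradient_pairing -[LHS]/(inner _ _) inner11; set g := _ + _.
rewrite -[LHS]tr11; congr (fun_of_matrix _ 0 0).
rewrite !trmx_mul S_sym !trmxK mulmxA mulmxA.
by rewrite -(mulmxA _ S S) S_invol mulmx1 mulmxA.
Qed.

Lemma inner_bracket a b (c : 'rV[R]_r) x : inner (bracket_value a b x) c =
  (vec a x *m N *m J b x *m S *m c^T) 0 0
  - (vec b x *m N *m J a x *m S *m c^T) 0 0
  + (c *m N *m J a x *m S *m (vec b x)^T) 0 0
  + inner (flux S T (vec a x) (vec b x)) c.
Proof.
rewrite /bracket_value !innerDl -scaleN1r innerZl mulN1r; congr (_ - _ + _ + _).
rewrite -[RHS]tr11 inner11 -(mulmxA _ S S) S_invol mulmx1.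
by rewrite !trmx_mul S_sym trmxK !mulmxA.
Qed.

(** In <[a,b], c> + <b, [a,c]> the terms <D_(rho b) a, c> and <D_(rho c) a, b>
    occur twice with opposite signs, and the flux drops out by skew-symmetry;
    what is left is <D_(rho a) b, c> + <b, D_(rho a) c>. *)
Lemma constant_Ca2 : Ca2 A.
Proof.
move=> a b c; change (bundleSection E) in a, b, c; apply: smoothFun_eq => x.
rewrite lie_derivative_anchorE gradient_pairing.
transitivity (inner (bracket_value a b x) (vec c x)
  + inner (bracket_value a c x) (vec b x)); last by rewrite [X in _ + X]innerC.
rewrite !inner_bracket [(_ + _)^T]linearD /= mulmxDr [LHS]mxE.
rewrite !trmx_mul S_sym !trmxK !mulmxA.
have /eqP := flux_inner S T (vec a x) (vec b x) (vec c x).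
have cancel (p p' q s k : R) :
  p + p' = p - q + s - k + (p' - s + q + k) by ring.
by rewrite addr_eq0 => /eqP ->; exact: cancel.
Qed.

(** This is rho rho^* = 0: the image of rho^* is isotropic. *)
Hypothesis N_isotropic : N^T *m S *m N = 0.

(** The term rho^* <D a, b> of the bracket is killed by the anchor, and the
    first two terms cancel against the Lie bracket of the vector fields rho(a)
    and rho(b), since the Hessian of a function is symmetric. *)
Lemma constant_curvature a b x :
  curvature (A := A) a b x = vector_at x (flux S T (vec a x) (vec b x) *m N).
Proof.
apply: tangent_eq => f; rewrite curvatureE.
have -> (g h k : C) : (g - (h - k)) x = g x - (h x - k x) by [].
rewrite !lie_derivative_anchorE !gradient_lie_derivative vector_atE.
rewrite -[vec _ x]/(bracket_value a b x) /bracket_value.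
rewrite !mulmxDl !mulNmx -(mulmxA _ N^T S) -(mulmxA _ (N^T *m S) N).
rewrite N_isotropic mulmx0 mul0mx addr0.
rewrite ![(_ + _)^T]linearD /= !mulmxDr !trmx_mul !trmxK hessian_sym !mulmxA.
have sym : (vec a x *m N *m hessian f x *m N^T *m (vec b x)^T) 0 0
         = (vec b x *m N *m hessian f x *m N^T *m (vec a x)^T) 0 0.
  by rewrite -[LHS]tr11 !trmx_mul !trmxK hessian_sym !mulmxA.
have cancel (p q k h : R) : p - q + k - (p + h - (q + h)) = k by ring.
by rewrite !add11 opp11 sym; exact: cancel.
Qed.

Lemma constant_ante_courant : ante_courant_algebroid A.
Proof.
split; first by split; [exact: constant_Ca1|exact: constant_Ca2].
- split=> f.
  + move=> a a' b x; change (bundleSection E) in a, a', b.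
    rewrite !constant_curvature.
    rewrite (_ : vec (f *s a + a') x = f x *: vec a x + vec a' x)//.
    by rewrite flux_linearl mulmxDl -scalemxAl linearP.
  + move=> a b b' x; change (bundleSection E) in a, b, b'.
    rewrite !constant_curvature.
    rewrite (_ : vec (f *s b + b') x = f x *: vec b x + vec b' x)//.
    by rewrite flux_linearr mulmxDl -scalemxAl linearP.
- move=> a b x; change (bundleSection E) in a, b.
  by rewrite !constant_curvature flux_skew mulNmx linearN.
Qed.

Lemma bracket_constant_section u v :
  constant_bracket (constant_section n u) (constant_section n v) =
  constant_section n (flux S T u v).
Proof.
have J0 w x : J (constant_section n w) x = 0.
  apply/matrixP => i j; rewrite !mxE.
  by rewrite /partial /= derive_cst.
apply: section_eq => x; rewrite [LHS]/= /bracket_value !J0.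
by rewrite trmx0 !mulmx0 !mul0mx subr0 !add0r.
Qed.

(** The derivatives of constant sections vanish, so on them the bracket is the
    product T(u,v), and (Ca3) becomes the Jacobi identity of that product. *)
Lemma constant_Ca3 u v w : Ca3 A ->
  flux S T u (flux S T v w) =
  flux S T (flux S T u v) w + flux S T v (flux S T u w).
Proof.
move=> /(_ (constant_section n u) (constant_section n v)
  (constant_section n w)).
rewrite /= !bracket_constant_section.
by move=> /(congr1 (fun s : bundleSection E => vec s 0)).
Qed.

End ConstantAlgebroid.

(** * The three examples *)

Section LieAlgebraOverPoint.
Variable R : realType.

Let I_sym : (1%:M : 'M[R]_5)^T = 1%:M. Proof. exact: trmx1. Qed.
Let I_invol : (1%:M : 'M[R]_5) *m 1%:M = 1%:M. Proof. exact: mulmx1. Qed.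
Let zero_isotropic : (0 : 'M[R]_(5, 0))^T *m 1%:M *m (0 : 'M[R]_(5, 0)) = 0.
Proof. exact: mulmx0. Qed.

Let e (i : 'I_5) : 'rV[R]_5 := delta_mx 0 i.
Local Notation e0 := (e (@Ordinal 5 0 isT)).
Local Notation e1 := (e (@Ordinal 5 1 isT)).
Local Notation e2 := (e (@Ordinal 5 2 isT)).
Local Notation e3 := (e (@Ordinal 5 3 isT)).
Local Notation e4 := (e (@Ordinal 5 4 isT)).

Let inner_e i j : inner 1%:M (e i) (e j) = (i == j :> nat)%:R.
Proof.
rewrite /inner mulmx1 /e trmx_delta mul_delta_mx_cond.
by rewrite -[_ == _ :> nat]/(i == j); case: eqP; rewrite !mxE.
Qed.

Let H := [:: (e0, e1, e2); (e0, e3, e4)].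

Let fluxE u v : flux 1%:M H u v = simple_flux 1%:M (e0, e1, e2) u v
  + simple_flux 1%:M (e0, e3, e4) u v.
Proof. by rewrite /flux !big_cons big_nil addr0. Qed.

Let simp := (mulr0, mul0r, mulr1, oppr0, subr0, sub0r, scale0r, scale1r,
  add0r, addr0).

Let flux12 : flux 1%:M H e1 e2 = e0.
Proof. by rewrite fluxE /simple_flux /= !inner_e /= !simp. Qed.

Let flux23 : flux 1%:M H e2 e3 = 0.
Proof. by rewrite fluxE /simple_flux /= !inner_e /= !simp. Qed.

Let flux13 : flux 1%:M H e1 e3 = 0.
Proof. by rewrite fluxE /simple_flux /= !inner_e /= !simp. Qed.

Let flux03 : flux 1%:M H e0 e3 = e4.
Proof. by rewrite fluxE /simple_flux /= !inner_e /= !simp. Qed.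

Definition point_algebroid :=
  constant_algebroid (0 : 'M[R]_(5, 0)) H I_sym I_invol.

(** Both T(e1, T(e2,e3)) and T(e2, T(e1,e3)) vanish, but T(T(e1,e2), e3) is
    T(e0,e3) = e4, so the Jacobi identity fails. *)
Lemma pre_courant_not_courant : exists (M : manifold R) (A : algebroid M),
  pre_courant_algebroid A /\ ~ courant_algebroid A.
Proof.
exists (euclidean R 0), point_algebroid; split.
  have [metric _ _] := constant_ante_courant H I_sym I_invol zero_isotropic.
  split=> // a b x; rewrite constant_curvature; last exact: zero_isotropic.
  by rewrite mulmx0 linear0.
move=> [_ ca3]; have := constant_Ca3 e1 e2 e3 ca3.
rewrite flux12 flux23 flux13 flux03 !flux0r addr0.
move=> /esym/(congr1 (fun u => inner 1%:M u e4)).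
by rewrite inner_e inner0l => /eqP; rewrite oner_eq0.
Qed.

End LieAlgebraOverPoint.

(** The bundle TM + T^*M over M = R^n, with <X + w, Y + z> = w(Y) + z(X) and
    the projection to TM as anchor. *)
Section GeneralizedTangentBundle.
Variables (R : realType) (n : nat).

Definition hyperbolic : 'M[R]_(n + n) := block_mx 0 1%:M 1%:M 0.

Definition tangent_projection : 'M[R]_(n + n, n) := col_mx 1%:M 0.

Lemma hyperbolic_sym : hyperbolic^T = hyperbolic.
Proof. by rewrite /hyperbolic tr_block_mx !trmx0 !trmx1. Qed.

Lemma hyperbolic_invol : hyperbolic *m hyperbolic = 1%:M.
Proof.
by rewrite mulmx_block !(mul0mx, mulmx0, mulmx1, add0r, addr0) -scalar_mx_block.
Qed.

Lemma tangent_projection_isotropic :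
  tangent_projection^T *m hyperbolic *m tangent_projection = 0.
Proof.
rewrite /tangent_projection /hyperbolic tr_col_mx trmx0 trmx1.
rewrite mul_row_block mul_row_col.
by rewrite !(mul0mx, mulmx0, mulmx1, add0r, addr0).
Qed.

Definition del (i : 'I_n) : 'rV[R]_(n + n) := row_mx (delta_mx 0 i) 0.
Definition dx (i : 'I_n) : 'rV[R]_(n + n) := row_mx 0 (delta_mx 0 i).

Lemma del_projection i : del i *m tangent_projection = delta_mx 0 i.
Proof. by rewrite mul_row_col mulmx1 mul0mx addr0. Qed.

Lemma dx_projection i : dx i *m tangent_projection = 0.
Proof. by rewrite mul_row_col mul0mx mulmx0 addr0. Qed.

Lemma inner_dx i u : inner hyperbolic (dx i) u = (u *m tangent_projection) 0 i.
Proof.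
rewrite innerC ?hyperbolic_sym// /inner -[u]hsubmxK.
rewrite mul_row_block tr_row_mx !mul_row_col.
rewrite !(mul0mx, mulmx0, mulmx1, add0r, addr0, trmx0) trmx_delta.
by rewrite -colE mxE.
Qed.

Lemma inner_del_del i j : inner hyperbolic (del i) (del j) = 0.
Proof.
rewrite /inner mul_row_block tr_row_mx mul_row_col.
by rewrite !(mul0mx, mulmx0, mulmx1, add0r, addr0, trmx0) mxE.
Qed.

Definition generalized_tangent T : algebroid (euclidean R n) :=
  constant_algebroid tangent_projection T hyperbolic_sym hyperbolic_invol.

Lemma generalized_tangent_ante_courant T :
  ante_courant_algebroid (generalized_tangent T).
Proof. exact: constant_ante_courant tangent_projection_isotropic. Qed.

Lemma generalized_tangent_curvature T a b x :
  curvature (A := generalized_tangent T) a b x =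
  vector_at x (flux hyperbolic T (vec a x) (vec b x) *m tangent_projection).
Proof. exact: constant_curvature tangent_projection_isotropic _ _ _. Qed.

End GeneralizedTangentBundle.

Section Planar.
Variable R : realType.
Local Notation i0 := (@Ordinal 2 0 isT).
Local Notation i1 := (@Ordinal 2 1 isT).

Lemma curved_courant_not_pre_courant :
  exists (M : manifold R) (A : algebroid M),
  curved_courant_algebroid A /\ ~ pre_courant_algebroid A.
Proof.
pose T := [:: (dx R i0, dx R i1, del R i0)].
have TE u v : flux (hyperbolic R 2) T u v *m tangent_projection R 2 =
    ((u *m tangent_projection R 2) 0 i0 * (v *m tangent_projection R 2) 0 i1
     - (u *m tangent_projection R 2) 0 i1 * (v *m tangent_projection R 2) 0 i0)
    *: delta_mx 0 i0.
  rewrite /flux big_seq1 /simple_flux /= !mulmxDl -!scalemxAl.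
  by rewrite del_projection !dx_projection !scaler0 !addr0 !inner_dx.
exists (euclidean R 2), (generalized_tangent T); split.
  have [metric bil skew] := generalized_tangent_ante_courant T.
  split=> // a b x a0; rewrite generalized_tangent_curvature TE.
  have -> : vec a x *m tangent_projection R 2 = 0 by exact: vector_at_eq0 a0.
  by rewrite !mxE !mul0r subrr scale0r linear0.
move=> [_ /(_ (constant_section 2 (del R i0))
  (constant_section 2 (del R i1)) 0)].
rewrite generalized_tangent_curvature TE => /vector_at_eq0/rowP/(_ i0)/eqP.
by rewrite /vec /= !del_projection !mxE /= !(mulr1, mulr0, subr0) oner_eq0.
Qed.

Lemma ante_courant_not_curved_courant :
  exists (M : manifold R) (A : algebroid M),
  ante_courant_algebroid A /\ ~ curved_courant_algebroid A.
Proof.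
pose T := [:: (del R i0, del R i1, dx R i0)].
exists (euclidean R 2), (generalized_tangent T); split.
  exact: generalized_tangent_ante_courant.
move=> [_ _ _ /(_ (constant_section 2 (dx R i0))
  (constant_section 2 (del R i0)) 0)].
have -> : anchor (generalized_tangent T) 0 (constant_section 2 (dx R i0) 0) = 0.
  rewrite -[LHS]/(vector_at _ (dx R i0 *m tangent_projection R 2)).
  by rewrite dx_projection linear0.
move=> /(_ erefl); rewrite generalized_tangent_curvature.
move=> /vector_at_eq0/rowP/(_ i1)/eqP.
rewrite /vec /= /flux big_seq1 /simple_flux /= !mulmxDl -!scalemxAl.
rewrite !del_projection dx_projection !inner_dx !inner_del_del.
rewrite (innerC (hyperbolic_sym R 2) (del R i0) (dx R i0)).
rewrite (innerC (hyperbolic_sym R 2) _ (dx R i0)).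
rewrite !inner_dx !del_projection !dx_projection !mxE /=.
rewrite !(mulr1, mulr0, subr0, sub0r, addr0, add0r, mul0r, oppr0).
by rewrite oppr_eq0 oner_eq0.
Qed.

End Planar.

Theorem corollary3p9 (R : realType) :
  [/\ (forall (M : manifold R) (A : algebroid M),
         courant_algebroid A -> pre_courant_algebroid A),
      (forall (M : manifold R) (A : algebroid M),
         pre_courant_algebroid A -> curved_courant_algebroid A) &
      (forall (M : manifold R) (A : algebroid M),
         curved_courant_algebroid A -> ante_courant_algebroid A)] /\
  [/\ (exists (M : manifold R) (A : algebroid M),
         pre_courant_algebroid A /\ ~ courant_algebroid A),
      (exists (M : manifold R) (A : algebroid M),
         curved_courant_algebroid A /\ ~ pre_courant_algebroid A) &
      (exists (M : manifold R) (A : algebroid M),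
         ante_courant_algebroid A /\ ~ curved_courant_algebroid A)].
Proof.
split; split.
- move=> M A [[ca1 ca2] ca3]; split=> // a b x; exact: courant_curvature0.
- move=> M A [metric F0]; split=> //.
  + by split=> f; move=> *; rewrite !F0 scaler0 addr0.
  + by move=> a b x; rewrite !F0 oppr0.
- by move=> M A [].
- exact: pre_courant_not_courant.
- exact: curved_courant_not_pre_courant.
- exact: ante_courant_not_curved_courant.
Qed.
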